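(* Let $N,K\ge 1$ be integers. There is a constant $C_3>0$, depending only on $N$ and $K$, such that the following holds. Let $A(z)=\sum_{k=0}^N a_kz^k$ and $B(z)=\sum_{k=0}^K b_kz^k$ be complex polynomials of degrees $N$ and $K$ respectively, with no common roots and with $\|A\|\le1$, $\|B\|\le 1$. Let $\delta=\delta(A,B)$ and $$M=\max\left(\frac{\|A\|}{|a_N|},\frac{\|B\|}{|b_K|}\right).$$ If $\mathfrak{S}=\mathfrak{S}(A,B)$ denotes the Sylvester matrix of $A$ and $B$, then $$\|\mathfrak{S}^{-1}\|\le\frac{C_3\,M^{N+K+\max(N,K)-1}}{\delta^2}.$$
   Context: For a polynomial $P(z)=p_0+\cdots+p_nz^n$, $\|P\|:=\max_i|p_i|$. For nonconstant polynomials $A,B$ with roots $\{\alpha_i\}_{i=1}^N$ and $\{\beta_j\}_{j=1}^K$ (listed with multiplicity), $\delta(A,B):=\min\{|A(\beta_j)|,|B(\alpha_i)| : 1\le i\le N,\ 1\le j\le K\}$; it is positive exactly when $A,B$ have no common roots. The Sylvester matrix $\mathfrak{S}(A,B)$ is the $(N+K)\times(N+K)$ matrix of the linear map $(R,S)\mapsto AR+BS$ (with $\deg R\le K-1$, $\deg S\le N-1$) in terms of coefficients. Explicitly, index rows and columns by $0,\dots,N+K-1$ and put $a_m=0$ for $m\notin\{0,\dots,N\}$, $b_m=0$ for $m\notin\{0,\dots,K\}$. For $0\le l\le K-1$ the entry in row $i$, column $l$ is $a_{i-l}$; for $0\le l\le N-1$ the entry in row $i$, column $K+l$ is $b_{i-l}$.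 It is invertible when $A$ and $B$ have no common roots. For a matrix, $\|\cdot\|$ denotes the operator norm induced by the Euclidean norm on $\mathbb{C}^{N+K}$ (any other fixed norm on the space of matrices only changes the constant $C_3$). *)

(* Defs.v *)
From HB Require Import structures.
From mathcomp Require Import all_boot all_order all_algebra.
From mathcomp Require Import all_classical all_reals.
From mathcomp Require Export complex.

Set Implicit Arguments.
Unset Strict Implicit.
Unset Printing Implicit Defensive.

Import Order.TTheory GRing.Theory Num.Theory.

Local Open Scope classical_set_scope.
Local Open Scope ring_scope.
Local Open Scope complex_scope.

(* The norm `|z| of [R[i]] takes its values in [R[i]]; [cmod z] is the modulus
   as an element of [R], where suprema are available. *)
Definition cmod (R : realType) (z : R[i]) : R := ComplexField.Normc.normc z.

Lemma cmodE (R : realType) (z : R[i]) : `|z| = (cmod z)%:C.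
Proof. by []. Qed.

Definition polynorm (R : realType) (P : {poly R[i]}) : R :=
  \big[Num.max/0]_(i < size P) cmod P`_i.

(* Roots listed with multiplicity. *)
Definition rootseq (R : realType) (P : {poly R[i]}) : seq R[i] :=
  sval (closed_field_poly_normal P).

Lemma rootseqP (R : realType) (P : {poly R[i]}) :
  P = lead_coef P *: \prod_(z <- rootseq P) ('X - z%:P).
Proof. exact: svalP (closed_field_poly_normal P). Qed.

Definition root_values (R : realType) (A B : {poly R[i]}) : seq R :=
  [seq cmod A.[b] | b <- rootseq B] ++ [seq cmod B.[a] | a <- rootseq A].

(* Starting the iterated minimum at the head of the list makes it the minimum
   of the list, which is nonempty when [A] or [B] is nonconstant. *)
Definition delta (R : realType) (A B : {poly R[i]}) : R :=
  let s := root_values A B in \big[Num.min/head 0 s]_(x <- s) x.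

(* [Sylvester_mx] writes the coefficients along rows, whereas the matrix of
   (U, V) |-> A * U + B * V on column vectors has them along columns. *)
Definition sylvester (R : realType) (A B : {poly R[i]}) :
    'M[R[i]]_((size B).-1 + (size A).-1) :=
  (Sylvester_mx A B)^T.

Lemma sylvesterE (R : realType) (A B : {poly R[i]})
    (i j : 'I_((size B).-1 + (size A).-1)) :
  sylvester A B i j =
    if (j < (size B).-1)%N then A`_(i - j) *+ (j <= i)%N
    else B`_(i - (j - (size B).-1)) *+ (j - (size B).-1 <= i)%N.
Proof.
rewrite mxE Sylvester_mxE /=.
by case: split_ordP => k -> //=; rewrite addKn.
Qed.

Lemma sylvester_unitmx (R : realType) (A B : {poly R[i]}) : A != 0 ->
  (forall z, ~~ (root A z && root B z)) -> sylvester A B \in unitmx.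
Proof.
move=> A0 AB; rewrite unitmx_tr unitmxE unitfE.
rewrite -[\det _]/(resultant A B) resultant_eq0 -leqNgt leqNgt; apply/negP => gt1.
have /closed_rootP[z] : size (gcdp A B) != 1%N by rewrite neq_ltn gt1 orbT.
by rewrite root_gcd; apply/negP.
Qed.

Definition norm2 (R : realType) (n : nat) (x : 'cV[R[i]]_n) : R :=
  Num.sqrt (\sum_(i < n) cmod (x i 0) ^+ 2).

Definition opnorm (R : realType) (n : nat) (S : 'M[R[i]]_n) : R :=
  sup [set norm2 (S *m x) | x in [set x : 'cV[R[i]]_n | norm2 x <= 1]].

(* Main.v *)
(** For subfamilies [a], [b] of the roots of [A], [B], let [W] solve
    [prod_a (X - x) * W = q] modulo [prod_b (X - y)], and follow the top
    coefficient of [W] modulo [prod_b (X - y)]. If [g1], [g2] are two points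
    of [a ++ b] at the largest distance [d], the identity
    [(g1 - g2) W = (X - g2) W - (X - g1) W] expresses this coefficient through
    the two analogous ones with [g2], resp. [g1], removed, at the cost of a
    factor [1 / d]. After removals until one of the families is empty, the
    diameters met when removing points of [a] have a product at least
    [|prod_a (y - x)|] for the surviving [y], and similarly for [b]; this is
    what replaces a power of [delta] growing with the degrees by [delta ^ 2].
    The coefficients of [U] in [A U + B V = P] are top coefficients of [U]
    times truncations of [B]. *)
Require Import Defs.
From mathcomp Require Import all_boot all_order all_algebra.
From mathcomp Require Import all_classical all_reals.
From mathcomp Require Import zify ring lra.

Set Implicit Arguments.
Unset Strict Implicit.
Unset Printing Implicit Defensive.

Import Order.TTheory GRing.Theory Num.Theory.

Local Open Scope ring_scope.
Local Open Scope complex_scope.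

#[local] Arguments cmod : simpl never.

(** * The real-valued modulus *)

Lemma cmod_ge0 (R : realType) (z : R[i]) : 0 <= cmod z.
Proof. by case: z => x y; rewrite /cmod /= sqrtr_ge0. Qed.

Lemma cmodM (R : realType) : {morph @cmod R : x y / x * y >-> x * y}.
Proof. by move=> x y; rewrite /cmod ComplexField.Normc.normcM. Qed.

Lemma cmod0 (R : realType) : cmod (0 : R[i]) = 0.
Proof. exact: ComplexField.Normc.normc0. Qed.

Lemma cmod1 (R : realType) : cmod (1 : R[i]) = 1.
Proof. exact: ComplexField.Normc.normc1. Qed.

Lemma cmodX (R : realType) n : {morph @cmod R : x / x ^+ n >-> x ^+ n}.
Proof. by move=> x; elim: n => [|n IH]; rewrite ?cmod1 // !exprS cmodM IH. Qed.

Lemma cmod_eq0 (R : realType) (z : R[i]) : (cmod z == 0) = (z == 0).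
Proof.
by apply/eqP/eqP => [/ComplexField.Normc.eq0_normc //|->]; rewrite cmod0.
Qed.

Lemma cmod_gt0 (R : realType) (z : R[i]) : (0 < cmod z) = (z != 0).
Proof. by rewrite lt_def cmod_ge0 andbT cmod_eq0. Qed.

Lemma le_cmodD (R : realType) (x y : R[i]) : cmod (x + y) <= cmod x + cmod y.
Proof.
have := ler_normD x y.
by rewrite !cmodE -rmorphD lecR.
Qed.

Lemma cmodN (R : realType) (x : R[i]) : cmod (- x) = cmod x.
Proof. by have := normrN x; rewrite !cmodE => -[]. Qed.

Lemma le_cmodB (R : realType) (x y : R[i]) : cmod (x - y) <= cmod x + cmod y.
Proof. by rewrite -(cmodN y) le_cmodD. Qed.

Lemma cmod_prod (R : realType) (I : Type) (s : seq I) (F : I -> R[i]) :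
  cmod (\prod_(i <- s) F i) = \prod_(i <- s) cmod (F i).
Proof. by rewrite (big_morph (@cmod R) (@cmodM R) (@cmod1 R)). Qed.

Lemma le_cmod_sum (R : realType) (I : Type) (s : seq I) (P : pred I)
    (F : I -> R[i]) :
  cmod (\sum_(i <- s | P i) F i) <= \sum_(i <- s | P i) cmod (F i).
Proof.
elim/big_rec2: _ => [|i x y _ H]; first by rewrite cmod0.
by rewrite (le_trans (le_cmodD _ _)) // lerD2l.
Qed.

(** * Top coefficients of remainders *)

(* The coefficient of [X^(d - 1)] modulo [D], where [d] is the degree of [D];
   it is [0] when [D] is constant. *)
Definition topmod (F : fieldType) (D p : {poly F}) : F := (p %% D)`_(size D).-2.

Lemma topmodD (F : fieldType) (D p q : {poly F}) :
  topmod D (p + q) = topmod D p + topmod D q.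
Proof. by rewrite /topmod modpD coefD. Qed.

Lemma topmodZ (F : fieldType) (D p : {poly F}) (c : F) :
  topmod D (c *: p) = c * topmod D p.
Proof. by rewrite /topmod modpZl coefZ. Qed.

Lemma topmodB (F : fieldType) (D p q : {poly F}) :
  topmod D (p - q) = topmod D p - topmod D q.
Proof. by rewrite topmodD -scaleN1r topmodZ mulN1r. Qed.

Lemma topmod_eq0 (F : fieldType) (D p : {poly F}) : D %| p -> topmod D p = 0.
Proof. by move=> /modp_eq0; rewrite /topmod => ->; rewrite coef0. Qed.

Lemma topmod_eqmod (F : fieldType) (D p q : {poly F}) :
  D %| p - q -> topmod D p = topmod D q.
Proof. by move=> /topmod_eq0; rewrite topmodB => /subr0_eq. Qed.

Lemma topmod1 (F : fieldType) (p : {poly F}) : topmod 1 p = 0.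
Proof. by rewrite topmod_eq0 // dvd1p. Qed.

Lemma topmod_sum (F : fieldType) (D : {poly F}) I (s : seq I) (P : pred I)
    (f : I -> {poly F}) :
  topmod D (\sum_(i <- s | P i) f i) = \sum_(i <- s | P i) topmod D (f i).
Proof.
apply: (big_morph (topmod D)) => [p q|]; first exact: topmodD.
by rewrite topmod_eq0 ?dvdp0.
Qed.

(** The remainder is multiplied by the monic factor ['X - x%:P], which preserves its top
    coefficient. For constant [D] both remainders vanish. *)
Lemma topmod_mul_XsubC (F : fieldType) (D p : {poly F}) (x : F) : D != 0 ->
  topmod (D * ('X - x%:P)) (p * ('X - x%:P)) = topmod D p.
Proof.
move=> D0; have X0 : 'X - x%:P != 0 :> {poly F} by rewrite polyXsubC_eq0.
have sD : (0 < size D)%N by rewrite size_poly_gt0.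
rewrite /topmod; set r := p %% D.
have sr : (size r < size D)%N by rewrite ltn_modp.
have -> : (p * ('X - x%:P)) %% (D * ('X - x%:P)) = r * ('X - x%:P).
  symmetry; apply: (@modpP _ _ (p %/ D)).
    by rewrite {1}(divp_eq p D) mulrDl mulrA.
  rewrite [X in (_ < X)%N]size_Mmonic ?monicXsubC // size_XsubC addn2 /=.
  by apply: leq_ltn_trans (size_polyMleq _ _) _; rewrite size_XsubC addn2.
rewrite size_Mmonic ?monicXsubC // size_XsubC addn2 /= mulrBr coefB coefMX coefMC.
case: (size D) sD sr => [//|[|n]] _ sr /=.
  by move: sr; rewrite ltnS leqn0 size_poly_eq0 => /eqP ->; rewrite !coef0; ring.
by rewrite [r`_n.+1]nth_default ?mul0r ?subr0 //; lia.
Qed.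

(** * Size of top coefficients modulo a product of linear factors *)

Local Notation rootprod s := (\prod_(z <- s) ('X - z%:P)).

Lemma rootprod_neq0 (F : fieldType) (s : seq F) : rootprod s != 0.
Proof. exact/monic_neq0/monic_prod_XsubC. Qed.

(** For nonempty [b] this top coefficient is the complete homogeneous symmetric polynomial of degree
    n + 1 - |b| in the points of [b], zero if that degree is negative. The weight [rho ^+ size b]
    makes the bound independent of [size b]. *)
Lemma topmod_Xn_le (R : realType) (rho : R) (b : seq R[i]) n : 0 <= rho ->
  {in b, forall z, cmod z <= rho} ->
  cmod (topmod (rootprod b) 'X^n) * rho ^+ size b <= 2 ^+ n * rho ^+ n.+1.
Proof.
move=> r0; elim: n b => [|n IH] [|z b] br.
- by rewrite big_nil topmod1 cmod0 mul0r mulr_ge0 ?exprn_ge0.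
(* The polynomial 1 is its own remainder, with top coefficient 1 for a single point and 0 for
   more. *)
- rewrite expr0 mul1r /topmod size_prod_XsubC modp_small; last first.
    by rewrite size_poly1 size_prod_XsubC.
  case: b {br} => [|y b] /=; rewrite coef1 /= ?cmod1 ?mul1r //.
  by rewrite cmod0 mul0r expr1.
- by rewrite big_nil topmod1 cmod0 mul0r mulr_ge0 ?exprn_ge0.
have zr : cmod z <= rho by rewrite br ?mem_head.
have br' : {in b, forall y, cmod y <= rho} by move=> y yb; rewrite br // inE yb orbT.
(* The first summand removes [z] from [b], the second costs a factor at most [rho]; having two
   summands accounts for the factor 2. *)
have -> : 'X^(n.+1) = 'X^n * ('X - z%:P) + z *: 'X^n :> {poly R[i]}.
  by rewrite mulrBr -exprSr -mul_polyC [z%:P * _]mulrC subrK.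
rewrite topmodD topmodZ {1}big_cons [_ * \prod_(_ <- _) _]mulrC.
rewrite topmod_mul_XsubC ?rootprod_neq0 //.
have H1 := IH _ br'; have H2 := IH _ br.
apply: le_trans (ler_wpM2r (exprn_ge0 _ r0) (le_cmodD _ _)) _.
rewrite cmodM mulrDl /=.
have -> : 2 ^+ n.+1 * rho ^+ n.+2 =
    rho * (2 ^+ n * rho ^+ n.+1) + rho * (2 ^+ n * rho ^+ n.+1).
  by rewrite !exprS; ring.
apply: lerD; first by rewrite exprS mulrCA ler_wpM2l.
rewrite -mulrA; apply: ler_pM => //; first exact: cmod_ge0.
by rewrite mulr_ge0 ?exprn_ge0 ?cmod_ge0.
Qed.

(** The bound is taken monomial by monomial; [1 <= rho] lets all powers be raised to the common
    exponent [s]. *)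
Lemma topmod_le (R : realType) (rho c : R) (b : seq R[i]) (q : {poly R[i]}) s :
  1 <= rho -> {in b, forall z, cmod z <= rho} ->
  (size q <= s)%N -> (forall n, (n < s)%N -> cmod q`_n <= c) ->
  cmod (topmod (rootprod b) q) * rho ^+ size b <= s%:R * c * (2 ^+ s * rho ^+ s).
Proof.
move=> r1 br qs qc; have r0 : 0 <= rho by lra.
rewrite -(take_poly_id qs) /take_poly poly_def topmod_sum.
apply: le_trans (ler_wpM2r (exprn_ge0 _ r0) (le_cmod_sum _ _ _)) _.
rewrite mulr_suml -mulrA mulr_natl -[X in _ *+ X](card_ord s) -sumr_const.
apply: ler_sum => i _; rewrite topmodZ cmodM -mulrA.
apply: ler_pM; rewrite ?cmod_ge0 ?mulr_ge0 ?exprn_ge0 ?cmod_ge0 ?qc //.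
apply: le_trans (topmod_Xn_le _ _ _) _ => //.
by apply: ler_pM; rewrite ?exprn_ge0 ?ler_weXn2l ?ler1n // ltnW.
Qed.

(** * Farthest points and removal of roots from two families *)

Lemma seq_max (R : realType) (T : eqType) (f : T -> R) (s : seq T) : s != [::] ->
  exists2 x, x \in s & {in s, forall y, f y <= f x}.
Proof.
elim: s => [//|z [|w s] IH] _.
  by exists z; rewrite ?mem_head // => y; rewrite inE => /eqP ->.
have [//|x xs xm] := IH; case: (leP (f z) (f x)) => [zx|xz].
  exists x; first by rewrite inE xs orbT.
  by move=> y; rewrite inE => /predU1P[-> //|/xm].
exists z; rewrite ?mem_head // => y; rewrite inE => /predU1P[-> //|/xm yx].
exact: le_trans yx (ltW xz).
Qed.

Lemma farthest_pair (R : realType) (s : seq R[i]) : s != [::] ->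
  exists x y, [/\ x \in s, y \in s &
    {in s &, forall u v, cmod (u - v) <= cmod (x - y)}].
Proof.
case: s => [//|z s] _; pose p := allpairs pair (z :: s) (z :: s).
have [//|[x y] /allpairsP[[u v] /= [us vs [-> ->]]] m] :=
  @seq_max R _ (fun w => cmod (w.1 - w.2)) p.
exists u, v; split=> // u' v' us' vs'.
by apply: (m (u', v')); apply/allpairsP; exists (u', v').
Qed.

Lemma prod_dist_le (R : realType) (x : R[i]) (b : seq R[i]) (d : R) :
  {in b, forall y, cmod (x - y) <= d} ->
  \prod_(y <- b) cmod (x - y) <= d ^+ size b.
Proof.
elim: b => [|y b IH] h; first by rewrite big_nil.
rewrite big_cons exprS; apply: ler_pM; rewrite ?cmod_ge0 ?h ?mem_head //.
  by apply: prodr_ge0 => *; exact: cmod_ge0.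
by apply: IH => z zb; rewrite h // inE zb orbT.
Qed.

(* [E] and [F] stand for lower bounds on [|prod_a|] over [b] and on [|prod_b|]
   over [a]; the bound on [F] by [rho] is what remains of the latter once [a]
   has become empty. *)
Lemma topmod_two_colors_le (R : realType) (rho G : R) (q : {poly R[i]}) n :
  forall (a b : seq R[i]) (W : {poly R[i]}) (E F : R),
  (size a + size b)%N = n -> 0 < E -> 0 < F ->
  {in a ++ b, forall x, cmod x <= rho} ->
  (forall t, {subset t <= b} ->
     cmod (topmod (rootprod t) q) * rho ^+ size t <= G) ->
  rootprod b %| rootprod a * W - q ->
  {in b, forall y, E <= \prod_(x <- a) cmod (y - x)} ->
  {in a, forall x, F <= \prod_(y <- b) cmod (x - y)} ->
  F <= (2 * rho) ^+ size b ->
  cmod (topmod (rootprod b) W) * (E * F) <= 2 ^+ (n + size b) * G.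
Proof.
elim: n => [|n IH] a b W E F sn E0 F0 ab_le Gq dvd Eb Fa Fb.
  case: a b sn {ab_le dvd Eb Fa Fb} Gq => [|//] [|//] _ /(_ [::]).
  by rewrite big_nil !topmod1 cmod0 !mul0r !expr0 mul1r => ->.
have G0 : 0 <= G.
  by have := Gq [::]; rewrite big_nil topmod1 cmod0 mul0r => ->.
case: b => [|y0 b0] in sn ab_le Gq dvd Eb Fa Fb *.
  by rewrite big_nil topmod1 cmod0 mul0r mulr_ge0 // exprn_ge0.
set b := y0 :: b0 in sn ab_le Gq dvd Eb Fa Fb *.
have y0b : y0 \in b by rewrite mem_head.
(* With [a] empty, [W] is congruent to [q] and [E] is at most the empty product 1, so [E * F] is at
   most [(2 * rho) ^+ size b]. The power of [rho] is absorbed by [Gq] at [b], the power of 2 by the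
   factor [2 ^+ size b] of the conclusion. *)
case: a => [|x0 a0] in sn ab_le dvd Eb Fa *.
  have E1 : E <= 1 by have := Eb _ y0b; rewrite big_nil.
  move: dvd; rewrite big_nil mul1r => /topmod_eqmod ->.
  have -> : 2 ^+ (n.+1 + size b) = 2 ^+ n.+1 * 2 ^+ size b :> R by rewrite exprD.
  apply: (@le_trans _ _ (cmod (topmod (rootprod b) q) * (2 * rho) ^+ size b)).
    rewrite ler_wpM2l ?cmod_ge0 // -[leRHS]mul1r.
    by apply: ler_pM => //; exact: ltW.
  have := Gq b (fun _ => id); set T := cmod _ => TG.
  have -> : T * (2 * rho) ^+ size b = 2 ^+ size b * (T * rho ^+ size b).
    by rewrite exprMn mulrCA.
  rewrite [_ * 2 ^+ _]mulrC -mulrA ler_wpM2l ?exprn_ge0 //.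
  by rewrite (le_trans TG) // ler_peMl // exprn_ege1 // ler1n.
set a := x0 :: a0 in sn ab_le dvd Eb Fa *.
have x0a : x0 \in a by rewrite mem_head.
have [|x [y [xab yab far]]] := @farthest_pair R (a ++ b); first by [].
set d := cmod (x - y) in far.
(* Since [0 < E], the points [x0] and [y0] differ, so the largest distance is nonzero. *)
have d_gt0 : 0 < d.
  apply: lt_le_trans (far y0 x0 _ _); rewrite ?mem_cat ?x0a ?y0b ?orbT //.
  rewrite lt_def cmod_ge0 andbT; apply: contraTneq E0 => yx.
  by rewrite -leNgt (le_trans (Eb _ y0b)) // big_cons yx mul0r.
(* Stated for any [g], since each of [x] and [y] may lie in either family. The factor lost from a
   product is a distance at most [d], so dividing [E] or [F] by [d] restores the lower bounds. *)
have step g : g \in a ++ b ->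
    cmod (topmod (rootprod b) (('X - g%:P) * W)) * (E * F) <=
    d * (2 ^+ (n + size b) * G).
  rewrite mem_cat => /orP[ga|gb].
    (* For [g] in [a], the polynomial [('X - g%:P) * W] solves the congruence with [g] removed from
       [a]. *)
    have sub : {subset rem g a <= a} := @mem_rem _ g a.
    have pa : rootprod a = ('X - g%:P) * rootprod (rem g a).
      by rewrite (perm_big _ (perm_to_rem ga)) big_cons.
    rewrite -ler_pdivrMl //.
    have -> (T : R) : d^-1 * (T * (E * F)) = T * (E / d * F) by ring.
    apply: (IH (rem g a)) => //.
    - by rewrite size_rem // -[in RHS]/(n.+1.-1) -sn addnC /a /= addnC.
    - by rewrite divr_gt0.
    - move=> z; rewrite mem_cat => /orP[/sub za|zb];
        by rewrite ab_le // mem_cat ?za ?zb ?orbT.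
    - by move: dvd; rewrite pa mulrCA mulrA.
    - move=> z zb; rewrite ler_pdivrMr // mulrC.
      apply: le_trans (Eb z zb) _; rewrite (perm_big _ (perm_to_rem ga)) big_cons.
      rewrite ler_wpM2r //; first by apply: prodr_ge0 => *; exact: cmod_ge0.
      by rewrite far // mem_cat ?zb ?ga ?orbT.
    - by move=> z /sub; exact: Fa.
  (* For [g] in [b], the factor ['X - g%:P] cancels against the modulus, and [W] itself solves the
     congruence modulo the smaller product. *)
  have sub : {subset rem g b <= b} := @mem_rem _ g b.
  have pb : rootprod b = rootprod (rem g b) * ('X - g%:P).
    by rewrite (perm_big _ (perm_to_rem gb)) big_cons mulrC.
  have sb : size b = (size (rem g b)).+1 by rewrite size_rem.
  have Fa' : {in a, forall x, F / d <= \prod_(y <- rem g b) cmod (x - y)}.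
    move=> z za; rewrite ler_pdivrMr // mulrC.
    apply: le_trans (Fa z za) _; rewrite (perm_big _ (perm_to_rem gb)) big_cons.
    rewrite ler_wpM2r //; first by apply: prodr_ge0 => *; exact: cmod_ge0.
    by rewrite far // mem_cat ?za ?gb ?orbT.
  rewrite -ler_pdivrMl //.
  rewrite pb [_ * W]mulrC topmod_mul_XsubC ?rootprod_neq0 //.
  have -> : d^-1 * (cmod (topmod (rootprod (rem g b)) W) * (E * F)) =
     cmod (topmod (rootprod (rem g b)) W) * (E * (F / d)) by ring.
  apply: (@le_trans _ _ (2 ^+ (n + size (rem g b)) * G)); last first.
    by rewrite ler_wpM2r // ler_weXn2l ?ler1n // sb addnS.
  apply: (IH a (rem g b)) => //.
  - by move: sn; rewrite sb addnS => -[].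
  - by rewrite divr_gt0.
  - move=> z; rewrite mem_cat => /orP[za|/sub zb];
      by rewrite ab_le // mem_cat ?za ?zb ?orbT.
  - by move=> t tb; apply: Gq => z /tb/sub.
  - by apply: dvdp_trans dvd; rewrite pb dvdp_mulr.
  - by move=> z /sub; exact: Eb.
  (* The point [x0] is still in [a], so [F / d] is at most the product of its distances to the
     remaining points of [b], each at most [2 * rho]. *)
  apply: le_trans (Fa' _ x0a) _; apply: prod_dist_le => z /sub zb.
  rewrite (le_trans (le_cmodB _ _)) // mulr_natl mulr2n.
  by rewrite lerD // ab_le // mem_cat ?x0a ?zb ?orbT.
(* This is the recursion of divided differences; its two terms raise the exponent of 2 by one. *)
have key : (x - y) * topmod (rootprod b) W =
    topmod (rootprod b) (('X - y%:P) * W) - topmod (rootprod b) (('X - x%:P) * W).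
  rewrite -topmodB -topmodZ; congr topmod.
  by rewrite -mulrBl -mul_polyC polyCB; congr (_ * _); ring.
rewrite -(ler_pM2l d_gt0) [leLHS]mulrA {1}/d -cmodM key.
apply: le_trans (ler_wpM2r _ (le_cmodB _ _)) _; first by rewrite mulr_ge0 // ltW.
rewrite mulrDl addSn exprS -mulrA [2 * _]mulr_natl mulr2n mulrDr.
by rewrite lerD ?step.
Qed.

(** * Reading off coefficients as top coefficients *)

(** The truncations [drop_poly k.+1 D] form the basis dual to the monomials for the bilinear form
    [topmod D (p * q)]. For i <= k the product has degree d - 1 - (k - i) and is its own
    remainder. *)
Lemma topmod_Xn_drop (F : fieldType) (D : {poly F}) d i k : D \is monic ->
  size D = d.+1 -> (i < d)%N -> (k < d)%N ->
  topmod D ('X^i * drop_poly k.+1 D) = (i == k)%:R.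
Proof.
move=> Dm sD iD kD; rewrite /topmod sD /=; case: (leqP i k) => [ik|ki].
  rewrite modp_small; last first.
    apply: leq_ltn_trans (size_polyMleq _ _) _.
    by rewrite size_polyXn size_drop_poly sD; lia.
  rewrite coefXnM coef_drop_poly ifN; last by lia.
  case: eqP => [->|ne]; last by rewrite nth_default // sD; lia.
  have -> : (d.-1 - k + k.+1 = (size D).-1)%N by rewrite sD; lia.
  by rewrite -[D`__]/(lead_coef D) (monicP Dm).
(* For i > k, subtracting a multiple of [D] leaves a shift of its low part, of degree below i and
   hence below d - 1. *)
have -> : 'X^i * drop_poly k.+1 D
    = 'X^(i - k.+1) * D - 'X^(i - k.+1) * take_poly k.+1 D.
  rewrite -{2}(poly_take_drop k.+1 D) mulrDr addrAC subrr add0r.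
  by rewrite mulrCA -exprD subnK // mulrC.
have st : (size ('X^(i - k.+1) * take_poly k.+1 D)%R <= i)%N.
  apply: leq_trans (size_polyMleq _ _) _.
  rewrite size_polyXn addSn /= (leq_trans (leq_add (leqnn _) (size_take_poly _ _))) //.
  by rewrite subnK.
rewrite modpD modp_mull add0r modpN modp_small; last first.
  by rewrite sD (leq_ltn_trans st) // ltnW.
by rewrite coefN nth_default ?oppr0 ?gtn_eqF //; apply: leq_trans st _; lia.
Qed.

Lemma topmod_mul_drop (F : fieldType) (D U : {poly F}) d k : D \is monic ->
  size D = d.+1 -> (size U <= d)%N -> (k < d)%N ->
  topmod D (U * drop_poly k.+1 D) = U`_k.
Proof.
move=> Dm sD sU kD.
rewrite -{1}(take_poly_id sU) /take_poly poly_def mulr_suml topmod_sum.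
rewrite (bigD1 (Ordinal kD)) //= big1 => [|i ik].
  by rewrite -scalerAl topmodZ (topmod_Xn_drop Dm sD) // eqxx mulr1 addr0.
rewrite -scalerAl topmodZ (topmod_Xn_drop Dm sD) //.
by rewrite -[_ == _]/(i == Ordinal kD) (negbTE ik) mulr0.
Qed.

(** * Roots, [delta], and the bound on Bezout coefficients *)

Lemma size_rootseq (R : realType) (A : {poly R[i]}) : A != 0 ->
  size (rootseq A) = (size A).-1.
Proof.
move=> A0; rewrite {2}(rootseqP A) size_scale ?lead_coef_eq0 //.
by rewrite size_prod_XsubC.
Qed.

Lemma cmod_horner_rootseq (R : realType) (A : {poly R[i]}) x :
  cmod A.[x] = cmod (lead_coef A) * \prod_(z <- rootseq A) cmod (x - z).
Proof.
rewrite {1}(rootseqP A) hornerZ cmodM horner_prod cmod_prod.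
by congr (_ * _); apply: eq_bigr => z _; rewrite hornerXsubC.
Qed.

Lemma root_rootseq (R : realType) (A : {poly R[i]}) z :
  z \in rootseq A -> root A z.
Proof.
by move=> zA; rewrite (rootseqP A) -mul_polyC rootM root_prod_XsubC zA orbT.
Qed.

Lemma coef_le_polynorm (R : realType) (P : {poly R[i]}) i :
  cmod P`_i <= polynorm P.
Proof.
rewrite /polynorm; case: (ltnP i (size P)) => [iP|Pi].
  exact: (le_bigmax _ (fun j : 'I_(size P) => cmod P`_j) (Ordinal iP)).
by rewrite nth_default // cmod0 bigmax_ge_id.
Qed.

(** A Cauchy-type bound: if |z| > 1, isolate the leading term of P(z) = 0 and divide by |z|^(n-1);
    the remaining case is covered by [1 <= M]. *)
Lemma root_le (R : realType) (P : {poly R[i]}) (M : R) z n : size P = n.+1 ->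
  1 <= M -> polynorm P / cmod P`_n <= M -> root P z ->
  cmod z <= n%:R * M.
Proof.
move=> sP M1 PM Pz.
have Pn : 0 < cmod P`_n.
  by rewrite cmod_gt0 -[n]/(n.+1.-1) -sP -[_`__]/(lead_coef P) lead_coef_eq0
    -size_poly_gt0 sP.
case: n => [|n] in sP PM Pn *.
  move: Pz Pn; rewrite (size1_polyC (eq_leq sP)) rootC => /eqP ->.
  by rewrite coef0 cmod0 ltxx.
case: (leP (cmod z) 1) => [z1|z1].
  apply: le_trans z1 _; rewrite -[leLHS]mulr1 ler_pM //.
  by rewrite ler1n.
have z0 : 0 < cmod z by lra.
have eqz : P`_n.+1 * z ^+ n.+1 = - \sum_(i < n.+1) P`_i * z ^+ i.
  apply/eqP; rewrite -addr_eq0 addrC.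
  by move/rootP: Pz; rewrite horner_coef sP big_ord_recr /= => ->.
have : cmod P`_n.+1 * cmod z ^+ n.+1 <= n.+1%:R * polynorm P * cmod z ^+ n.
  rewrite -cmodX -cmodM eqz cmodN (le_trans (le_cmod_sum _ _ _)) //.
  rewrite -mulrA mulr_natl -[X in _ *+ X](card_ord n.+1) -sumr_const.
  apply: ler_sum => i _; rewrite cmodM cmodX.
  rewrite ler_pM ?cmod_ge0 ?exprn_ge0 ?cmod_ge0 ?coef_le_polynorm //.
  by rewrite ler_weXn2l ?(ltW z1) // -ltnS.
rewrite exprS mulrA ler_pM2r ?exprn_gt0 // mulrC -ler_pdivlMr // -mulrA.
by move/le_trans; apply; rewrite ler_wpM2l.
Qed.

Lemma delta_le (R : realType) (A B : {poly R[i]}) :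
  {in root_values A B, forall x, delta A B <= x}.
Proof. by move=> x xs; rewrite /delta; apply: ge_bigmin_seq. Qed.

Lemma delta_gt0 (R : realType) (A B : {poly R[i]}) : (1 < size A)%N ->
  (forall z, ~~ (root A z && root B z)) -> 0 < delta A B.
Proof.
move=> sA noroot.
have pos : {in root_values A B, forall x, 0 < x}.
  move=> x; rewrite mem_cat => /orP[|] /mapP[z /root_rootseq zr ->].
    by rewrite cmod_gt0; have := noroot z; rewrite zr andbT.
  by rewrite cmod_gt0; have := noroot z; rewrite zr.
have : (0 < size (root_values A B))%N.
  rewrite size_cat !size_map [size (rootseq A)]size_rootseq.
    by rewrite addn_gt0 -subn1 subn_gt0 sA orbT.
  by rewrite -size_poly_gt0 ltnW.
rewrite /delta; case: (root_values A B) pos => [//|x s] pos _ /=.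
rewrite big_seq; elim/big_ind: _ => [|u v u0 v0|u /pos //].
  by rewrite pos ?mem_head.
by rewrite lt_min u0.
Qed.

Lemma bezout_coef_le (R : realType) (A B U V : {poly R[i]}) N K e (del rho : R) k :
  size A = N.+1 -> size B = K.+1 -> (0 < N)%N ->
  polynorm B <= 1 -> (size U <= K)%N ->
  (size (A * U + B * V)%R <= N + K)%N ->
  (forall i, cmod (A * U + B * V)`_i <= 1) ->
  0 < del ->
  {in rootseq B, forall y, del <= cmod A.[y]} ->
  {in rootseq A, forall x, del <= cmod B.[x]} ->
  1 <= rho -> {in rootseq A ++ rootseq B, forall z, cmod z <= rho} ->
  (N + K + K - 1 <= e)%N -> (k < K)%N ->
  cmod U`_k * del ^+ 2 <= 2 ^+ (N + K + K) * (e%:R * e%:R * (2 ^+ e * rho ^+ e)).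
Proof.
set P := A * U + B * V.
move=> sA sB N0 B1 sU sP P1 d0 dA dB r1 zr eNK kK.
have lA : 0 < cmod (lead_coef A) by rewrite cmod_gt0 lead_coef_eq0 -size_poly_gt0 sA.
have lB : 0 < cmod (lead_coef B) by rewrite cmod_gt0 lead_coef_eq0 -size_poly_gt0 sB.
have szA : size (rootseq A) = N by rewrite size_rootseq -?size_poly_gt0 sA.
have szB : size (rootseq B) = K by rewrite size_rootseq -?size_poly_gt0 sB.
(* Truncating [B] rather than its monic multiple keeps the coefficients at most 1. *)
set D := drop_poly k.+1 B.
set W := lead_coef A *: (U * D).
set q := P * D.
have sD : (size D <= K)%N by rewrite size_drop_poly sB subSS leq_subr.
have D1 i : cmod D`_i <= 1.
  by rewrite coef_drop_poly (le_trans (coef_le_polynorm _ _)).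
have sq : (size q <= e)%N.
  apply: leq_trans (size_polyMleq _ _) _; apply: leq_trans eNK.
  by rewrite -subn1 leq_sub2r // leq_add.
(* A convolution of at most [e] products of modulus at most 1. *)
have qe n : (n < e)%N -> cmod q`_n <= e%:R.
  move=> ne; rewrite coefM (le_trans (le_cmod_sum _ _ _)) //.
  apply: (@le_trans _ _ (\sum_(i < n.+1) 1)); last first.
    by rewrite sumr_const card_ord ler_nat.
  by apply: ler_sum => i _; rewrite cmodM -[leRHS]mulr1 ler_pM ?cmod_ge0.
have Drop : D = lead_coef B *: drop_poly k.+1 (rootprod (rootseq B)).
  by rewrite /D {1}(rootseqP B) drop_polyZ.
have top : topmod (rootprod (rootseq B)) W = lead_coef A * lead_coef B * U`_k.
  rewrite topmodZ -mulrA Drop -scalerAr topmodZ; congr (_ * (_ * _)).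
  by apply: topmod_mul_drop kK; rewrite ?monic_prod_XsubC ?size_prod_XsubC ?szB.
have Fb x : x \in rootseq A ->
    del / cmod (lead_coef B) <= \prod_(y <- rootseq B) cmod (x - y).
  move=> xA; rewrite ler_pdivrMr // mulrC -cmod_horner_rootseq; exact: dB.
have := @topmod_two_colors_le R rho (e%:R * e%:R * (2 ^+ e * rho ^+ e)) q (N + K)
  (rootseq A) (rootseq B) W (del / cmod (lead_coef A)) (del / cmod (lead_coef B)).
rewrite top szA szB => key.
(* The leading coefficients in [top] cancel exactly those dividing [del] in the two lower bounds. *)
have -> : cmod U`_k * del ^+ 2 = cmod (lead_coef A * lead_coef B * U`_k) *
   (del / cmod (lead_coef A) * (del / cmod (lead_coef B))).
  rewrite !cmodM; field; by rewrite (gt_eqF lA) (gt_eqF lB).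
apply: key => //; first exact: divr_gt0.
- exact: divr_gt0.
- move=> t tb; apply: topmod_le => // z /tb zb; apply: zr.
  by rewrite mem_cat zb orbT.
- have -> : rootprod (rootseq A) * W - q = B * - (V * D).
    have -> : rootprod (rootseq A) * W = A * (U * D).
      by rewrite /W -scalerAr scalerAl -rootseqP.
    by rewrite /q /P; ring.
  apply: dvdp_mulr; rewrite {2}(rootseqP B) dvdpZr //.
  by rewrite -cmod_gt0.
- move=> y yB; rewrite ler_pdivrMr // mulrC -cmod_horner_rootseq; exact: dA.
(* As [0 < N], there is a root of [A]; its distances to the roots of [B], each at most [2 * rho],
   bound [F]. *)
have : (0 < size (rootseq A))%N by rewrite szA.
case: (rootseq A) Fb zr => [//|x s] Fb zr _.
apply: le_trans (Fb x (mem_head _ _)) _; rewrite -szB.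
apply: prod_dist_le => y yB; rewrite (le_trans (le_cmodB _ _)) // mulr_natl mulr2n.
by rewrite lerD // zr // mem_cat ?mem_head ?yB ?orbT.
Qed.

(** * Euclidean norm and operator norm *)

Lemma norm2_le (R : realType) n (x : 'cV[R[i]]_n) (X : R) :
  (forall i, cmod (x i 0) <= X) -> norm2 x <= n%:R * X.
Proof.
case: n x => [|n] x xX.
  by rewrite /norm2 big_ord0 sqrtr0 mul0r.
have X0 : 0 <= X := le_trans (cmod_ge0 _) (xX 0).
have nX0 : 0 <= n.+1%:R * X by rewrite mulr_ge0.
rewrite -(ger0_norm nX0) -sqrtr_sqr ler_wsqrtr //.
apply: (@le_trans _ _ (\sum_(i < n.+1) X ^+ 2)).
  by apply: ler_sum => i _; rewrite ler_pXn2r ?nnegrE ?cmod_ge0.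
rewrite sumr_const card_ord -[X in X <= _]mulr_natl exprMn ler_wpM2r ?sqr_ge0 //.
by rewrite expr2 ler_peMl ?ler1n.
Qed.

Lemma cmod_le_norm2 (R : realType) n (x : 'cV[R[i]]_n) i :
  cmod (x i 0) <= norm2 x.
Proof.
rewrite -(ger0_norm (cmod_ge0 (x i 0))) -sqrtr_sqr ler_wsqrtr //.
rewrite (bigD1 i) //= lerDl; apply: sumr_ge0 => j _; exact: sqr_ge0.
Qed.

Lemma opnorm_le (R : realType) n (S : 'M[R[i]]_n) (X : R) :
  (forall x, norm2 x <= 1 -> norm2 (S *m x) <= X) -> opnorm S <= X.
Proof.
move=> SX; apply: ge_sup; last by move=> _ [x x1 <-]; exact: SX.
(* Bounding the supremum requires a nonempty set; the zero vector provides an element. *)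
exists (norm2 (S *m 0)); exists 0 => //=.
rewrite (le_trans (norm2_le (X := 0) _)) ?mulr0 // => i.
by rewrite mxE cmod0.
Qed.

(** * The Sylvester matrix and the Bezout equation *)

Lemma size_mul_le (F : nzSemiRingType) (p q : {poly F}) m : (0 < size q)%N ->
  (size p <= m)%N -> (size (p * q)%R <= m + (size q).-1)%N.
Proof.
move=> q0 pm; apply: leq_trans (size_polyMleq _ _) _.
by rewrite -{1}(prednK q0) addnS leq_add2r.
Qed.

(** Each block of [Sylvester_mx] is multiplication by a polynomial followed by [poly_rV]; the size
    bounds ensure that no coefficient is cut off. *)
Lemma sylvester_mulmx (R : realType) (A B : {poly R[i]})
    (y : 'cV[R[i]]_((size B).-1 + (size A).-1)) :
  (0 < size A)%N -> (0 < size B)%N ->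
  A * rVpoly (lsubmx y^T) + B * rVpoly (rsubmx y^T)
    = rVpoly (sylvester A B *m y)^T.
Proof.
move=> sA sB; rewrite trmx_mul trmxK -[y^T in RHS]hsubmxK mul_row_col !mul_rV_lin1 /=.
rewrite linearD /= !poly_rV_K.
- by rewrite mulrC [B * _]mulrC.
- by rewrite [X in (_ <= X)%N]addnC size_mul_le // size_poly.
- by rewrite size_mul_le // size_poly.
Qed.

(** * Assembly of the bound on the inverse *)

Unset Implicit Arguments.

Theorem theorem6p3 (R : realType) (N K : nat) (hN : (1 <= N)%N) (hK : (1 <= K)%N) :
  exists C3 : R, 0 < C3 /\
    forall A B : {poly R[i]},
      size A = N.+1 -> size B = K.+1 ->
      (forall z : R[i], ~~ (root A z && root B z)) ->
      polynorm A <= 1 -> polynorm B <= 1 ->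
      let M := Num.max (polynorm A / cmod A`_N) (polynorm B / cmod B`_K) in
      opnorm (invmx (sylvester A B)) <=
        C3 * M ^+ (N + K + maxn N K - 1) / delta A B ^+ 2.
Proof.
(* The maximum makes [e] dominate both N + 2K - 1, needed for [U], and K + 2N - 1, needed for [V].
   The factor [(N + K)%:R ^+ e] in [c] comes from the root bound [(N + K)%:R * M]. *)
set e := (N + K + maxn N K - 1)%N.
set c : R := 2 ^+ (N + K + maxn N K) * (e%:R * e%:R * (2 ^+ e * (N + K)%:R ^+ e)).
have NK0 : (0 < N + K)%N by rewrite addn_gt0 hN.
have e0 : (0 < e)%N by rewrite /e; lia.
have c0 : 0 < c by rewrite !mulr_gt0 ?exprn_gt0 ?ltr0n.
exists ((N + K)%:R * c); split=> [|A B sA sB noroot A1 B1].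
  by rewrite mulr_gt0 ?ltr0n.
cbv zeta; set M := Num.max _ _.
have sA0 : (0 < size A)%N by rewrite sA.
have sB0 : (0 < size B)%N by rewrite sB.
have A0 : A != 0 by rewrite -size_poly_gt0.
have d0 : 0 < delta A B by rewrite delta_gt0 // sA.
have lA : 0 < cmod A`_N.
  by rewrite cmod_gt0 -[N]/(N.+1.-1) -sA -[_`__]/(lead_coef A) lead_coef_eq0.
have M1 : 1 <= M.
  by rewrite le_max ler_pdivlMr // mul1r coef_le_polynorm.
set rho := (N + K)%:R * M.
have r1 : 1 <= rho by rewrite -[leLHS]mulr1 ler_pM ?ler1n.
have zr : {in rootseq A ++ rootseq B, forall z, cmod z <= rho}.
  move=> z; rewrite mem_cat => /orP[] /root_rootseq zr.
    rewrite (le_trans (root_le sA M1 _ zr)) ?le_max ?lexx //.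
    by rewrite ler_wpM2r ?ler_nat ?leq_addr // (le_trans ler01).
  rewrite (le_trans (root_le sB M1 _ zr)) ?le_max ?lexx ?orbT //.
  by rewrite ler_wpM2r ?ler_nat ?leq_addl // (le_trans ler01).
have dA : {in rootseq B, forall y, delta A B <= cmod A.[y]}.
  by move=> y yB; rewrite delta_le // mem_cat (map_f (fun z => cmod A.[z])).
have dB : {in rootseq A, forall x, delta A B <= cmod B.[x]}.
  by move=> x xA; rewrite delta_le // mem_cat (map_f (fun z => cmod B.[z])) ?orbT.
have S_unit := sylvester_unitmx A0 noroot.
apply: opnorm_le => x x1; set y := _ *m x.
have Sy : sylvester A B *m y = x by rewrite mulKVmx.
(* The entries of [y] are the coefficients of [U] and [V], and the right-hand side of their Bezout
   equation has coefficients at most 1 because [norm2 x <= 1]. *)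
have := sylvester_mulmx y sA0 sB0; rewrite Sy.
set U := rVpoly _; set V := rVpoly _ => AUBV.
have sP : (size (rVpoly x^T) <= K + N)%N.
  by apply: leq_trans (size_poly _ _) _; rewrite sA sB.
have P1 i : cmod (rVpoly x^T)`_i <= 1.
  rewrite coef_rVpoly; case: insub => [j|]; last by rewrite cmod0.
  by rewrite mxE (le_trans (cmod_le_norm2 _ _)).
have sU : (size U <= K)%N by apply: leq_trans (size_poly _ _) _; rewrite sB.
have sV : (size V <= N)%N by apply: leq_trans (size_poly _ _) _; rewrite sA.
have eqX n : (n <= N + K + maxn N K)%N ->
    2 ^+ n * (e%:R * e%:R * (2 ^+ e * rho ^+ e)) <= c * M ^+ e.
  move=> ne; rewrite /rho exprMn /c -!mulrA ler_wpM2r //.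
    by rewrite !mulr_ge0 ?exprn_ge0 // (le_trans ler01).
  by rewrite ler_weXn2l ?ler1n.
have UX k : (k < K)%N -> cmod U`_k * delta A B ^+ 2 <= c * M ^+ e.
  move=> kK; apply: le_trans (eqX (N + K + K)%N _); last first.
    by rewrite leq_add2l leq_maxr.
  apply: (bezout_coef_le sA sB (V := V)) => //; rewrite ?AUBV //.
    by rewrite [X in (_ <= X)%N]addnC.
  by rewrite /e leq_sub2r // leq_add2l leq_maxr.
have VX k : (k < N)%N -> cmod V`_k * delta A B ^+ 2 <= c * M ^+ e.
  move=> kN; apply: le_trans (eqX (K + N + N)%N _); last first.
    by rewrite [(K + N)%N]addnC leq_add2l leq_maxl.
  (* The bound for [V] follows by exchanging the roles of [A] and [B]. *)
  have BVAU : B * V + A * U = rVpoly x^T by rewrite addrC.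
  apply: (bezout_coef_le sB sA (V := U)) => //; rewrite ?BVAU //.
  - by move=> z; rewrite mem_cat orbC -mem_cat; exact: zr.
  - by rewrite /e [(K + N)%N]addnC leq_sub2r // leq_add2l leq_maxl.
(* The factor N + K is the dimension, lost in passing from entries to the Euclidean norm. *)
have -> : (N + K)%:R * c * M ^+ e / delta A B ^+ 2
    = ((size B).-1 + (size A).-1)%:R * (c * M ^+ e / delta A B ^+ 2).
  by rewrite sA sB /= [(K + N)%N]addnC -!mulrA.
apply: norm2_le => i; rewrite ler_pdivlMr ?exprn_gt0 //.
case: (split_ordP i) => j ->.
  have -> : y (lshift _ j) 0 = U`_j by rewrite coef_rVpoly_ord !mxE.
  by apply: UX; case: j => j /=; rewrite sB.
have -> : y (rshift _ j) 0 = V`_j by rewrite coef_rVpoly_ord !mxE.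
by apply: VX; case: j => j /=; rewrite sA.
Qed.
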